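(* The Banach rings $c_0$, $c$, and $\ell_\infty$ are Hirsch.
   Context: $\ell_\infty$ is the Banach ring of all bounded sequences $(x_i)_{i\in\omega}$ of real (or complex) numbers, endowed with the sup-norm $\|(x_i)_{i\in\omega}\|_{\ell_\infty}=\sup_{i\in\omega}|x_i|$ and coordinatewise multiplication; $c$ is its Banach subring of convergent sequences; $c_0$ is the Banach subring of $c$ consisting of sequences that converge to zero. A series $\sum_{n\in\omega}x_n$ in an Abelian topological group $G$ unconditionally converges to $x\in G$ if for any neighborhood $U$ of $0$ there is a finite set $F\subset\omega$ such that $\sum_{i\in J}x_i\in x+U$ for any finite set $J\subset\omega$ containing $F$; it is unconditionally convergent if it unconditionally converges to some $x\in G$. A topological ring $R$ is Hirsch if for any unconditionally convergent series $\sum_{n\in\omega}x_n$ in $R$ and any neighborhood $U\subseteq R$ of $0$ there exists a neighborhood $V\subseteq R$ of $0$ such that $\sum_{n\in F}a_nx_n\in U$ for any finite set $F\subset\omega$ and any sequence $(a_n)_{n\in F}\in V^F$. *)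

(* Defs.v *)
From HB Require Import structures.
From mathcomp Require Import all_boot all_order all_algebra finmap.
From mathcomp Require Import all_classical all_reals all_analysis.
From mathcomp Require Import complex.

Set Implicit Arguments.
Unset Strict Implicit.
Unset Printing Implicit Defensive.

Import Order.TTheory GRing.Theory Num.Theory.
Import numFieldNormedType.Exports.

Local Open Scope classical_set_scope.
Local Open Scope ring_scope.

(* Topological rings, not assumed unital: [c_0] has no unit, and the ring
   structures of MathComp all carry one. *)
HB.mixin Record isTopologicalRng M & TopologicalZmodule M := {
  rmul : M -> M -> M;
  rmulA : associative rmul;
  rmulDl : left_distributive rmul +%R;
  rmulDr : right_distributive rmul +%R;
  rmul_continuous : continuous (fun x : M * M => rmul x.1 x.2)
}.

#[short(type="topologicalRngType")]
HB.structure Definition TopologicalRng :=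
  {M of TopologicalZmodule M & isTopologicalRng M}.

Definition unconditionally_converges_to (G : topologicalZmodType)
    (x : nat -> G) (s : G) : Prop :=
  forall U : set G, nbhs 0 U ->
    exists F : {fset nat}, forall J : {fset nat}, (F `<=` J)%fset ->
      [set s + u | u in U] (\sum_(i <- J) x i).

Definition unconditionally_convergent (G : topologicalZmodType)
    (x : nat -> G) : Prop :=
  exists s : G, unconditionally_converges_to x s.

Definition hirsch (M : topologicalRngType) : Prop :=
  forall x : nat -> M, unconditionally_convergent x ->
  forall U : set M, nbhs 0 U ->
  exists2 V : set M, nbhs 0 V &
    forall (F : {fset nat}) (a : nat -> M),
      (forall n, n \in F -> V (a n)) -> U (\sum_(n <- F) rmul (a n) (x n)).

(* In MathComp-Analysis the norm of a normed module over [K] takes its values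
   in [K]. This property, proved below for [R] and [R[i]], says that the
   sup-norm of a bounded sequence exists in [K]; it serves to treat the real
   and the complex scalars at once. *)
HB.mixin Record hasNormSup K & Num.NumField K := {
  norm_supremums : forall A : set K, A !=set0 -> (forall a, A a -> 0 <= a) ->
    has_ubound A -> supremums A !=set0
}.

#[short(type="scalarType")]
HB.structure Definition Scalar := {K of Num.NumField K & hasNormSup K}.

(* The instances that [numFieldNormedType] gives to each numeric structure. *)
Section ScalarNormedModule.
Variable K : scalarType.
#[non_forgetful_inheritance]
HB.instance Definition _ := GRing.ComAlgebra.copy K K^o.
#[non_forgetful_inheritance]
HB.instance Definition _ := Vector.copy K K^o.
#[non_forgetful_inheritance]
HB.instance Definition _ := NormedModule.copy K K^o.
#[non_forgetful_inheritance]
HB.instance Definition _ := Num.NumField.on K.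
End ScalarNormedModule.

Section RealScalars.
Variable R : realType.

Lemma real_norm_supremums (A : set R) : A !=set0 ->
  (forall a, A a -> 0 <= a) -> has_ubound A -> supremums A !=set0.
Proof.
move=> A0 _ Aub; exists (sup A); split; first exact: ub_le_sup.
by move=> y Ay; apply: ge_sup.
Qed.

HB.instance Definition _ := hasNormSup.Build R real_norm_supremums.

End RealScalars.

Section ComplexScalars.
Variable R : realType.

Lemma complex_norm_supremums (A : set R[i]) : A !=set0 ->
  (forall a, A a -> 0 <= a) -> has_ubound A -> supremums A !=set0.
Proof.
move=> [a0 Aa0] A_ge0 [M AM].
have imA a : A a -> complex.Im a = 0.
  by move/A_ge0; rewrite lecE => /andP[/eqP].
have ReA0 : [set complex.Re a | a in A] !=set0.
  by exists (complex.Re a0), a0.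
have ReAub : has_ubound [set complex.Re a | a in A].
  exists (complex.Re M) => _ [a Aa <-].
  by have := AM _ Aa; rewrite lecE => /andP[].
exists (Complex (sup [set complex.Re a | a in A]) 0); split.
  move=> a Aa; rewrite lecE /= imA // eqxx /=.
  by apply: ub_le_sup => //; exists a.
move=> y Ay; rewrite lecE /=; apply/andP; split.
  by have := Ay _ Aa0; rewrite lecE (imA _ Aa0) => /andP[].
apply: ge_sup => // _ [a Aa <-].
by have := Ay _ Aa; rewrite lecE => /andP[].
Qed.

HB.instance Definition _ := hasNormSup.Build R[i] complex_norm_supremums.

End ComplexScalars.

Section SequenceRings.
Variable K : scalarType.
Implicit Types u v : nat -> K.

(* Sets of bounded sequences closed under the coordinatewise operations, not
   necessarily containing the constant sequence 1. *)
Record seq_rng := SeqRng {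
  seqs :> set (nat -> K);
  seqs_bounded : forall u, seqs u -> bounded_fun u;
  seqs0 : seqs 0;
  seqsD : forall u v, seqs u -> seqs v -> seqs (u + v);
  seqsZ : forall k u, seqs u -> seqs (k *: u);
  seqsM : forall u v, seqs u -> seqs v -> seqs (u * v)
}.

Variable S : seq_rng.

Record seq_space := SeqSpace {
  terms :> nat -> K;
  termsP : terms \in (S : set (nat -> K))
}.

HB.instance Definition _ := [isSub for terms].
HB.instance Definition _ := [Choice of seq_space by <:].

Lemma seqs_subsemimod_closed :
  GRing.subsemimod_closed (mem (S : set (nat -> K))).
Proof.
split; first split.
- by rewrite inE; exact: seqs0.
- by move=> u v; rewrite !inE; exact: seqsD.
- by move=> k u; rewrite !inE; exact: seqsZ.
Qed.

HB.instance Definition _ := GRing.SubChoice_isSubLmodule.Build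
  K (nat -> K) _ seq_space seqs_subsemimod_closed.

Implicit Types x y : seq_space.

(* The supremum exists by [sup_norm_supremums]; the default 0 is not used. *)
Definition sup_norm x : K := supremum 0 (range (fun n => `|x n|)).

Lemma termsD x y n : (x + y) n = x n + y n.
Proof. by []. Qed.

Lemma termsZ (k : K) x n : (k *: x) n = k * x n.
Proof. by []. Qed.

Lemma sup_norm_supremums x :
  supremums (range (fun n => `|x n|)) (sup_norm x).
Proof.
rewrite /sup_norm /supremum ifF; last first.
  by apply/negbTE/set0P; exists `|x 0%N|, 0%N.
apply: xgetPex; apply: norm_supremums.
- by exists `|x 0%N|, 0%N.
- by move=> _ [n _ <-].
- have /pinfty_ex_gt0[M _ xM] : bounded_fun (x : nat -> K).
    by apply: (@seqs_bounded S); apply/set_mem/termsP.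
  by exists M => _ [n _ <-]; exact: xM.
Qed.

Lemma norm_le_sup x n : `|x n| <= sup_norm x.
Proof. by apply: (sup_norm_supremums x).1; exists n. Qed.

Lemma sup_norm_le x (M : K) : (forall n, `|x n| <= M) -> sup_norm x <= M.
Proof. by move=> xM; apply: (sup_norm_supremums x).2 => _ [n _ <-]. Qed.

Lemma sup_norm_ge0 x : 0 <= sup_norm x.
Proof. exact: le_trans (norm_le_sup x 0%N). Qed.

Lemma sup_normD x y : sup_norm (x + y) <= sup_norm x + sup_norm y.
Proof.
apply: sup_norm_le => n; rewrite termsD.
by apply: le_trans (ler_normD _ _) _; rewrite lerD ?norm_le_sup.
Qed.

Lemma sup_normZ (k : K) x : sup_norm (k *: x) = `|k| * sup_norm x.
Proof.
apply/le_anti/andP; split.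
  by apply: sup_norm_le => n; rewrite termsZ normrM ler_wpM2l ?norm_le_sup.
have [->|k0] := eqVneq k 0; first by rewrite normr0 mul0r sup_norm_ge0.
rewrite -ler_pdivlMl ?normr_gt0 //; apply: sup_norm_le => n.
by rewrite ler_pdivlMl ?normr_gt0 // -normrM -termsZ norm_le_sup.
Qed.

Lemma sup_norm_eq0 x : sup_norm x = 0 -> x = 0.
Proof.
move=> x0; apply/val_inj/funext => n; apply/eqP; rewrite -normr_le0.
by rewrite -x0; exact: norm_le_sup.
Qed.

HB.instance Definition _ := Lmodule_isNormed.Build
  K seq_space sup_normD sup_normZ sup_norm_eq0.

Lemma seq_mul_subproof x y :
  (terms x * terms y) \in (S : set (nat -> K)).
Proof. by apply/mem_set/seqsM; exact/set_mem/termsP. Qed.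

Definition seq_mul x y : seq_space := SeqSpace (seq_mul_subproof x y).

Lemma seq_mulA : associative seq_mul.
Proof. by move=> x y z; apply/val_inj; exact: mulrA. Qed.

Lemma seq_mulDl : left_distributive seq_mul +%R.
Proof. by move=> x y z; apply/val_inj; exact: mulrDl. Qed.

Lemma seq_mulDr : right_distributive seq_mul +%R.
Proof. by move=> x y z; apply/val_inj; exact: mulrDr. Qed.

Lemma seq_mul_norm x y : `|seq_mul x y| <= `|x| * `|y|.
Proof.
by apply: sup_norm_le => n; rewrite normrM ler_pM ?norm_le_sup.
Qed.

Lemma seq_mul_continuous :
  continuous (fun z : seq_space * seq_space => seq_mul z.1 z.2).
Proof.
move=> [x y] /=; apply/cvgrPdist_le => e e0.
have M0 : 0 < `|x| + (1 + `|y|) by rewrite ltr_wpDl // ltr_pwDl.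
near=> z.
have zx : `|x - z.1| <= e / (`|x| + (1 + `|y|)).
  near: z; apply: (@cvgr_dist_le _ _ _ (nbhs (x, y)) _ fst x); first exact: cvg_fst.
  by rewrite divr_gt0.
have zy : `|y - z.2| <= e / (`|x| + (1 + `|y|)).
  near: z; apply: (@cvgr_dist_le _ _ _ (nbhs (x, y)) _ snd y); first exact: cvg_snd.
  by rewrite divr_gt0.
have zy1 : `|y - z.2| <= 1.
  by near: z; apply: (@cvgr_dist_le _ _ _ (nbhs (x, y)) _ snd y); first exact: cvg_snd.
have z2 : `|z.2| <= 1 + `|y|.
  rewrite -[z.2](subrK y); apply: le_trans (ler_normD _ _) _.
  by rewrite lerD2r distrC.
have -> : seq_mul x y - seq_mul z.1 z.2 =
    seq_mul x (y - z.2) + seq_mul (x - z.1) z.2.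
  apply/val_inj/funext => n.
  change (x n * y n - z.1 n * z.2 n =
    x n * (y n - z.2 n) + (x n - z.1 n) * z.2 n).
  by rewrite mulrBr mulrBl addrA subrK.
apply: le_trans (ler_normD _ _) _.
rewrite -[e in leRHS](divfK (lt0r_neq0 M0)) mulrDr lerD //.
  apply: le_trans (seq_mul_norm _ _) _.
  by rewrite mulrC ler_wpM2r.
by apply: le_trans (seq_mul_norm _ _) _; rewrite ler_pM.
Unshelve. all: by end_near. Qed.

HB.instance Definition _ := isTopologicalRng.Build seq_space
  seq_mulA seq_mulDl seq_mulDr seq_mul_continuous.

End SequenceRings.

Section ClassicalSequenceRings.
Variable K : scalarType.
Implicit Types (u v : nat -> K) (k : K).

Lemma bounded_seqP u : bounded_fun u <-> exists M : K, forall n, `|u n| <= M.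
Proof.
split=> [/pinfty_ex_gt0[M _ uM]|[M uM]]; first by exists M => n; exact: uM.
rewrite /= /bounded_near; near=> N => n _ /=; apply: le_trans (uM n) _.
near: N; apply: nbhs_pinfty_ge.
by rewrite ger0_real // (le_trans _ (uM 0%N)).
Unshelve. all: by end_near. Qed.

Lemma bounded_seq0 : bounded_fun (0 : nat -> K).
Proof. by apply/bounded_seqP; exists 0 => n; rewrite normr0. Qed.

Lemma bounded_seqD u v : bounded_fun u -> bounded_fun v -> bounded_fun (u + v).
Proof.
move=> /bounded_seqP[M uM] /bounded_seqP[N vN]; apply/bounded_seqP.
by exists (M + N) => n; apply: le_trans (ler_normD _ _) _; rewrite lerD.
Qed.

Lemma bounded_seqZ k u : bounded_fun u -> bounded_fun (k *: u).
Proof.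
move=> /bounded_seqP[M uM]; apply/bounded_seqP.
by exists (`|k| * M) => n; rewrite normrM ler_wpM2l.
Qed.

Lemma bounded_seqM u v : bounded_fun u -> bounded_fun v -> bounded_fun (u * v).
Proof.
move=> /bounded_seqP[M uM] /bounded_seqP[N vN]; apply/bounded_seqP.
by exists (M * N) => n; rewrite normrM ler_pM.
Qed.

Definition bounded_seqs : seq_rng K := @SeqRng K [set u | bounded_fun u]
  (fun _ => id) bounded_seq0 bounded_seqD bounded_seqZ bounded_seqM.

Lemma cvg_seq0 : cvgn (0 : nat -> K).
Proof. exact: is_cvg_cst. Qed.

Lemma cvg_seqD u v : cvgn u -> cvgn v -> cvgn (u + v).
Proof. exact: is_cvgD. Qed.

Lemma cvg_seqZ k u : cvgn u -> cvgn (k *: u).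
Proof. exact: is_cvgZl_tmp. Qed.

Lemma cvg_seqM u v : cvgn u -> cvgn v -> cvgn (u * v).
Proof. exact: is_cvgM. Qed.

Definition convergent_seqs : seq_rng K := @SeqRng K [set u | cvgn u]
  (@cvg_seq_bounded _ _) cvg_seq0 cvg_seqD cvg_seqZ cvg_seqM.

Lemma null_seq_bounded u : u @ \oo --> (0 : K) -> bounded_fun u.
Proof. by move=> u0; apply: cvg_seq_bounded; apply/cvg_ex; exists 0. Qed.

Lemma null_seq0 : (0 : nat -> K) @ \oo --> (0 : K).
Proof. exact: cvg_cst. Qed.

Lemma null_seqD u v : u @ \oo --> (0 : K) -> v @ \oo --> (0 : K) ->
  (u + v) @ \oo --> (0 : K).
Proof. by move=> u0 v0; rewrite -[0]addr0; exact: cvgD. Qed.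

Lemma null_seqZ k u : u @ \oo --> (0 : K) -> (k *: u) @ \oo --> (0 : K).
Proof. by move=> u0; rewrite -[0](mulr0 k); exact: cvgMl_tmp. Qed.

Lemma null_seqM u v : u @ \oo --> (0 : K) -> v @ \oo --> (0 : K) ->
  (u * v) @ \oo --> (0 : K).
Proof. by move=> u0 v0; rewrite -[0](mulr0 0); exact: cvgM. Qed.

Definition null_seqs : seq_rng K := @SeqRng K [set u | u @ \oo --> (0 : K)]
  null_seq_bounded null_seq0 null_seqD null_seqZ null_seqM.

End ClassicalSequenceRings.

Notation ell_infty K := (seq_space (bounded_seqs K)).
Notation seq_c K := (seq_space (convergent_seqs K)).
Notation seq_c0 K := (seq_space (null_seqs K)).

(* Main.v *)
Require Import Defs.
From mathcomp Require Import all_boot all_algebra.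
From mathcomp Require Import all_classical all_reals all_analysis.
From mathcomp Require Import complex.
From mathcomp Require Import all_order finmap.

(** An unconditionally convergent series in a normed space has uniformly bounded
finite subsums. In a ring of bounded sequences this holds at every coordinate
with the same bound [B], and scalars whose subsums are bounded by [B] have
absolute sum at most [C * B] ([C = 2] over the reals, by splitting according to
sign; [C = 4] over the complex numbers, by splitting into real and imaginary
parts). Hence multiplying the terms by sequences of norm at most [d] yields
finite sums of norm at most [d * (C * B)]. *)

Import Order.TTheory GRing.Theory Num.Theory.
Import numFieldNormedType.Exports.

Local Open Scope classical_set_scope.
Local Open Scope ring_scope.

(** Finite sums over sets containing a suitable finite [F0] lie within 1 of the limit [s]. The sum
    over any [J] is the sum over the union of [F0] and [J] minus a subsum over [F0], and the latter
    is at most the sum of the norms over [F0]. *)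
Lemma unconditionally_convergent_subsums_bounded (K : numFieldType)
    (V : normedModType K) (x : nat -> V) :
  unconditionally_convergent x ->
  exists B : K, forall J : {fset nat}, `|\sum_(i <- J) x i| <= B.
Proof.
move=> [s xs].
have U1 : nbhs (0 : V) (ball 0 (1 : K)) by exact: nbhsx_ballx.
have [F0 xF0] := xs _ U1.
exists (`|s| + 1 + \sum_(i <- F0) `|x i|) => J.
have xE : \sum_(i <- J) x i =
    \sum_(i <- (F0 `|` J)%fset) x i - \sum_(i <- F0 | i \notin J) x i.
  rewrite (big_fsetID _ (mem J) (F0 `|` J)%fset) /=.
  rewrite (_ : [fset i | i in F0 `|` J & i \in J]%fset = J); last first.
    apply/fsetP => i; rewrite !inE.
    by case: (i \in J); rewrite ?orbT ?andbF.
  rewrite (_ : [fset i | i in F0 `|` J & i \notin J]%fset =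
      [fset i in F0 | i \notin J]%fset); last first.
    apply/fsetP => i; rewrite !inE.
    by case: (i \in J); rewrite ?orbF ?andbF.
  by rewrite -big_fset_condE addrK.
rewrite xE; apply: le_trans (ler_normB _ _) _; apply: lerD.
  have [u u1 <-] := xF0 (F0 `|` J)%fset (fsubsetUl _ _).
  apply: le_trans (ler_normD _ _) _; rewrite lerD2l.
  by move: u1; rewrite -ball_normE /= sub0r normrN => /ltW.
apply: le_trans (ler_norm_sum _ _ _) _.
by rewrite big_mkcond /=; apply: ler_sum => i _; case: ifP.
Qed.

(** The only property of the scalars that the Hirsch estimate needs; [C] depends on neither the
    family nor its length. *)
Definition bounded_subsums_summable (K : numDomainType) (C : K) : Prop :=
  forall (s : seq nat) (u : nat -> K) (B : K),
    (forall P : pred nat, `|\sum_(n <- s | P n) u n| <= B) ->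
    \sum_(n <- s) `|u n| <= C * B.

Lemma bounded_subsums_summable_real (R : realDomainType) :
  bounded_subsums_summable R 2.
Proof.
move=> s u B uB; rewrite (bigID (fun n => 0 <= u n)) /= mulr_natl mulr2n lerD//.
  apply: le_trans (uB (fun n => 0 <= u n)).
  by rewrite (eq_bigr u) ?ler_norm// => n /ger0_norm.
apply: le_trans (uB (fun n => ~~ (0 <= u n))).
rewrite -normrN -sumrN (eq_bigr (fun n => - u n)) ?ler_norm// => n.
by rewrite -ltNge => /ltr0_norm.
Qed.

Lemma normc_ge_Im (R : rcfType) (z : R[i]) :
  (`|complex.Im z|%:C <= `|z|)%C.
Proof.
by rewrite normc_def lecR -sqrtr_sqr ler_wsqrtr// lerDr sqr_ge0.
Qed.

(** After squaring, the two sides differ by the nonnegative cross term. *)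
Lemma normc_le_ReDIm (R : rcfType) (z : R[i]) :
  (`|z| <= (`|complex.Re z| + `|complex.Im z|)%:C)%C.
Proof.
rewrite normc_def lecR -[leRHS]ger0_norm ?addr_ge0// -[leRHS]sqrtr_sqr.
rewrite ler_wsqrtr// sqrrD !real_normK ?num_real// lerD2r lerDl.
by rewrite mulrn_wge0// mulr_ge0.
Qed.

Lemma bounded_subsums_summable_complex (R : rcfType) :
  bounded_subsums_summable R[i] 4.
Proof.
move=> s u B uB.
(* The empty subsum gives [0 <= B], which in [R[i]] forces [B] to be real; the real case then
   applies with bound [Re B]. *)
have B0 : 0 <= B by apply: le_trans (uB pred0).
have BE : ((complex.Re B)%:C)%C = B by rewrite RRe_real// ger0_real.
(* Here [p] stands for the real or the imaginary part. *)
have part_sum (p : R[i] -> R) : p 0 = 0 -> {morph p : y z / y + z} ->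
    (forall z : R[i], `|p z|%:C%C <= `|z|) ->
    \sum_(n <- s) `|p (u n)| <= 2 * complex.Re B.
  move=> p0 pD p_le; apply: bounded_subsums_summable_real => P.
  rewrite -(big_morph p pD p0) -lecR BE.
  exact: le_trans (p_le _) (uB P).
apply: (@le_trans _ _ (\sum_(n <- s)
    (`|complex.Re (u n)| + `|complex.Im (u n)|)%:C%C)).
  by apply: ler_sum => n _; exact: normc_le_ReDIm.
rewrite -(rmorph_sum (real_complex R)) big_split /=.
have -> : 4 * B = (2 * complex.Re B + 2 * complex.Re B)%:C%C.
  by rewrite -mulrDl rmorphM/= BE -natrD rmorph_nat.
rewrite lecR lerD// part_sum//.
- by case=> a b [].
- exact: normc_ge_Re.
- by case=> a b [].
- exact: normc_ge_Im.
Qed.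

Lemma hirsch_seq_space (K : scalarType) (S : seq_rng K) (C : K) :
  0 <= C -> bounded_subsums_summable K C -> hirsch (seq_space S).
Proof.
move=> C0 sumC x /unconditionally_convergent_subsums_bounded [B xB] U.
have B0 : 0 <= B by apply: le_trans (xB fset0).
move=> /nbhs_ballP[e /= e0 eU].
(* Adding 1 permits division even if [C * B = 0], and later makes the bound strictly less than [e],
   as membership in the open ball requires. *)
have CB0 : 0 < C * B + 1 by rewrite ltr_wpDl ?mulr_ge0.
exists (ball 0 (e / (C * B + 1))).
  by apply: nbhsx_ballx; rewrite divr_gt0.
move=> F a aV; apply: eU.
rewrite -ball_normE /= sub0r normrN.
have aF n : n \in F -> `|a n| <= e / (C * B + 1).
  by move=> /aV; rewrite -ball_normE /= sub0r normrN => /ltW.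
have term_sum s (P : pred nat) (y : nat -> seq_space S) k :
    terms (\sum_(n <- s | P n) y n) k = \sum_(n <- s | P n) y n k.
  by elim/big_rec2 : _ => // n z y' _ <-; rewrite termsD.
have d0 : 0 <= e / (C * B + 1) by rewrite ltW// divr_gt0.
apply: (@le_lt_trans _ _ (e / (C * B + 1) * (C * B))); last first.
  by rewrite mulrAC ltr_pdivrMr// ltr_pM2l// ltrDl.
apply: sup_norm_le => k; rewrite term_sum.
apply: le_trans (ler_norm_sum _ _ _) _.
apply: (@le_trans _ _ (\sum_(n <- F) e / (C * B + 1) * `|x n k|)).
  rewrite big_seq [leRHS]big_seq; apply: ler_sum => n nF.
  by rewrite normrM ler_wpM2r// (le_trans (norm_le_sup _ k))// aF.
rewrite -mulr_sumr ler_wpM2l//; apply: sumC => P.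
(* A subsum of the [k]-th coordinates is the [k]-th coordinate of a finite subsum of [x], so [B]
   serves for every [k]. *)
rewrite -term_sum (le_trans (norm_le_sup _ k))//.
by rewrite big_fset_condE; exact: xB.
Qed.

Theorem theorem7p3 (R : realType) :
  [/\ hirsch (seq_c0 R), hirsch (seq_c R) & hirsch (ell_infty R)] /\
  [/\ hirsch (seq_c0 R[i]), hirsch (seq_c R[i]) & hirsch (ell_infty R[i])].
Proof.
have hR := bounded_subsums_summable_real R.
have hC := bounded_subsums_summable_complex R.
split; split.
- exact: (hirsch_seq_space R (null_seqs R) 2 (ler0n _ _) hR).
- exact: (hirsch_seq_space R (convergent_seqs R) 2 (ler0n _ _) hR).
- exact: (hirsch_seq_space R (bounded_seqs R) 2 (ler0n _ _) hR).
- exact: (hirsch_seq_space R[i] (null_seqs R[i]) 4 (ler0n _ _) hC).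
- exact: (hirsch_seq_space R[i] (convergent_seqs R[i]) 4 (ler0n _ _) hC).
- exact: (hirsch_seq_space R[i] (bounded_seqs R[i]) 4 (ler0n _ _) hC).
Qed.
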